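(* Let $\lambda_1,\dots,\lambda_N>0$ be linearly independent over $\mathbb{Z}$, let $(a_{kj})_{1\le k,j\le N}$ be a real matrix, $b_1,\dots,b_N\in\mathbb{R}$, and let $a_1,\dots,a_N$ be nonzero real numbers. For $\varepsilon>0$ let $(u_1^\varepsilon,\dots,u_N^\varepsilon)$ be the solution of $$\ddot u_k^\varepsilon+\lambda_k^2u_k^\varepsilon=-\varepsilon\Big(\sum_{j=1}^Na_{kj}u_j^\varepsilon-b_k\Big)_+,\qquad u_k^\varepsilon(0)=a_k,\quad\dot u_k^\varepsilon(0)=0,\qquad k=1,\dots,N.$$ Set $v_k^0(s)=a_k\cos(s)$, $\lambda_k^\varepsilon=\lambda_k+\varepsilon\lambda_k^1$, where $$\lambda_k^1=\frac{1}{\lambda_ka_k}\lim_{T\to+\infty}\frac1T\int_0^T\Big(\sum_{j=1}^Na_{kj}\,v_j^0\Big(\frac{\lambda_j}{\lambda_k}s\Big)-b_k\Big)_+\cos(s)\,ds.$$ Then, for any $T_\varepsilon=o(\varepsilon^{-1})$, i.e. such that $\lim_{\varepsilon\to0}T_\varepsilon=+\infty$ and $\lim_{\varepsilon\to0}\varepsilon T_\varepsilon=0$, one has for all $k=1,\dots,N$ $$\lim_{\varepsilon\to0}\big\|u_k^\varepsilon(t)-v_k^0(\lambda_k^\varepsilon t)\big\|_{W^{2,\infty}(0,T_\varepsilon)}=0.$$ Furthermore, if $b_k=0$, then $\displaystyle\lambda_k^1=\frac{a_{kk}}{4\lambda_k}$.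
   Context: For real $x$, $x_+=\max(0,x)$. Linear independence over $\mathbb{Z}$ means that $\sum_kn_k\lambda_k=0$ with $n_k\in\mathbb{Z}$ implies all $n_k=0$. *)

(* Defs.v *)
From HB Require Import structures.
From mathcomp Require Import all_boot all_order all_algebra.
From mathcomp Require Import all_classical all_reals all_analysis.

Set Implicit Arguments.
Unset Strict Implicit.
Unset Printing Implicit Defensive.

Import Order.TTheory GRing.Theory Num.Theory.
Import numFieldNormedType.Exports.

Local Open Scope classical_set_scope.
Local Open Scope ring_scope.

Definition lin_indep_int (R : realType) (N : nat) (lambda : 'I_N -> R) : Prop :=
  forall n : 'I_N -> int,
    \sum_(k < N) (n k)%:~R * lambda k = 0 -> forall k, n k = 0.

Definition pos_part (R : realType) (x : R) : R := Num.max 0 x.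

(* Derivative of f, regarded as a function on [0, +oo[, at t >= 0: one-sided
   for t = 0, two-sided for t > 0. *)
Definition has_deriv_nneg (R : realType) (f : R -> R) (t l : R) : Prop :=
  (fun h => h^-1 * (f (t + h) - f t)) @ within [set h | 0 <= t + h] 0^' --> l.

Definition is_solution (R : realType) (N : nat) (lambda : 'I_N -> R)
    (A : 'M[R]_N) (b a : 'I_N -> R) (eps : R) (u : 'I_N -> R -> R) : Prop :=
  exists du : 'I_N -> R -> R, forall k : 'I_N,
    [/\ u k 0 = a k, du k 0 = 0 &
        forall t, 0 <= t ->
          has_deriv_nneg (u k) t (du k t) /\
          has_deriv_nneg (du k) t
            (- eps * pos_part (\sum_(j < N) A k j * u j t - b k)
             - lambda k ^+ 2 * u k t)].

Definition v0 (R : realType) (N : nat) (a : 'I_N -> R) (k : 'I_N) (s : R) : R :=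
  a k * cos s.

Definition mean_forcing (R : realType) (N : nat) (lambda : 'I_N -> R)
    (A : 'M[R]_N) (b a : 'I_N -> R) (k : 'I_N) (T : R) : R :=
  T^-1 * \int[lebesgue_measure]_(s in `[0, T])
    (pos_part (\sum_(j < N) A k j * v0 a j (lambda j / lambda k * s) - b k)
     * cos s).

Definition lambda1 (R : realType) (N : nat) (lambda : 'I_N -> R)
    (A : 'M[R]_N) (b a : 'I_N -> R) (k : 'I_N) : R :=
  (lambda k * a k)^-1 * lim (mean_forcing lambda A b a k T @[T --> +oo]).

Definition test_function (R : realType) (D : set R) (phi : R -> R) : Prop :=
  (forall n x, derivable (derive1n n phi) x 1) /\
  exists K : set R, [/\ compact K, K `<=` D & forall x, ~ K x -> phi x = 0].

Definition is_weak_deriv (R : realType) (D : set R) (n : nat) (f g : R -> R) :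
    Prop :=
  [/\ locally_integrable D f, locally_integrable D g &
      forall phi, test_function D phi ->
        \int[lebesgue_measure]_(x in D) (f x * derive1n n phi x) =
        (-1) ^+ n * \int[lebesgue_measure]_(x in D) (g x * phi x)].

(* The norm of W^{m,oo}(D), as an extended real. Weak derivatives are unique up
   to null sets, so all the sums in the infimum are equal; the infimum is over
   the empty set, hence +oo, when some weak derivative fails to exist. Extending
   g i by 0 outside D does not change its L^oo norm. *)
Definition sobolev_inf_norm (R : realType) (m : nat) (D : set R) (f : R -> R) :
    \bar R :=
  ereal_inf
    [set (\sum_(i < m.+1) 'N[lebesgue_measure]_+oo[EFin \o (g i \_ D)])%E
    | g in [set g : nat -> R -> R |
             forall i, (i <= m)%N -> is_weak_deriv D i f (g i)]].

(* Main.v *)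
Require Import Defs.
From mathcomp Require Import all_boot all_order all_algebra.
From mathcomp Require Import all_classical all_reals all_analysis.
From mathcomp Require Import ess_sup_inf.
From mathcomp Require Import ring lra zify.
Set Implicit Arguments.
Unset Strict Implicit.
Unset Printing Implicit Defensive.
Import Order.TTheory GRing.Theory Num.Theory.
Import numFieldNormedType.Exports.
Local Open Scope classical_set_scope.
Local Open Scope ring_scope.

(** Existence of the limit defining [lambda1].  With X the trigonometric sum
inside the positive part, x_+ = (x + |x|) / 2 reduces the question to the time
means of X(s) cos s and |X(s)| cos s.  A finite sum of cosines has a time mean,
which only sees the frequency 0 ([trigsum_has_mean], [trigsum_has_mean0]), and
|X| is a uniform limit of polynomials in X ^ 2, hence of finite sums of cosines
([trigsum_abs_approx]); time means pass to uniform limits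
([has_mean_unif_approx]).

Value of the limit when [b k = 0].  Every frequency of X is then one of the
[lambda j / lambda k], so X ^ 2 and the approximations of |X| only contain
combinations of these frequencies with an even coefficient sum.  Multiplying by
cos s makes the coefficient sum odd, and an odd combination cannot vanish by
linear independence.  So |X(s)| cos s has mean 0 and the limit is half the
resonant term of X(s) cos s ([has_mean_pos_part_indep]).

Convergence.  On [0, T_eps] the phase shift eps * lambda1 * t tends to 0
uniformly, because eps * T_eps does, so replacing lambda by lambda + eps *
lambda1 changes a cosine by o(1) in C^2.  It is therefore enough to compare u
with a cos (lambda t).  An energy estimate with Gronwall's inequality bounds u,
hence the nonlinear force, independently of eps as long as eps * t <= 1
([unilateral_force_bounded]).  The difference to the free oscillation is then
forced by a term of size eps, and a second energy estimate bounds it by a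
function of eps * T_eps that vanishes at 0 ([oscillator_estimate],
[sobolev_detuned_oscillator]).  These estimates are uniform in t for the
function and its two classical derivatives, which are weak derivatives by
integration by parts ([sobolev_inf_norm2_le]). *)

(** * Calculus on the line *)

Section Calculus.
Context {R : realType}.
Implicit Types (f g F : R -> R) (t w T : R).

Lemma is_derive_continuous f g :
  (forall t : R, is_derive t 1 f (g t)) -> continuous f.
Proof.
move=> df t; apply: differentiable_continuous.
by apply/derivable1_diffP; case: (df t).
Qed.

(** The instances for [f + g], [k *: f] and [f * g] differentiate in the ring of
functions; these rules apply to functions given by pointwise formulas. *)
Lemma is_deriveD_pt f g df dg t : is_derive t 1 f df -> is_derive t 1 g dg ->
  is_derive t 1 (fun s => f s + g s) (df + dg).
Proof. by move=> hf hg; exact: is_deriveD. Qed.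

Lemma is_derive_cstD_pt (c : R) f df t : is_derive t 1 f df ->
  is_derive t 1 (fun s => c + f s) df.
Proof.
move=> hf; rewrite -(add0r df).
exact: is_deriveD_pt (is_derive_cst c t 1) hf.
Qed.

Lemma is_deriveB_pt f g df dg t : is_derive t 1 f df -> is_derive t 1 g dg ->
  is_derive t 1 (fun s => f s - g s) (df - dg).
Proof. by move=> hf hg; exact: is_deriveB. Qed.

Lemma is_deriveZ_pt f c df t : is_derive t 1 f df ->
  is_derive t 1 (fun s => c * f s) (c * df).
Proof. by move=> hf; exact: (@is_deriveZ _ _ _ f c). Qed.

Lemma is_deriveM_pt f g df dg t : is_derive t 1 f df -> is_derive t 1 g dg ->
  is_derive t 1 (fun s => f s * g s) (df * g t + f t * dg).
Proof.
move=> hf hg; have := is_deriveM hf hg.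
by rewrite /GRing.scale/= addrC [g t * _]mulrC.
Qed.

Lemma is_derive_sqr_pt f df t : is_derive t 1 f df ->
  is_derive t 1 (fun s => f s ^+ 2) (2 * f t * df).
Proof.
move=> hf; have -> : 2 * f t * df = df * f t + f t * df by ring.
exact: is_deriveM_pt.
Qed.

Lemma is_derive_sum_pt n (h dh : 'I_n -> R -> R) t :
  (forall i, is_derive t 1 (h i) (dh i t)) ->
  is_derive t 1 (fun s => \sum_(i < n) h i s) (\sum_(i < n) dh i t).
Proof.
move=> hh; have -> : (fun s => \sum_(i < n) h i s) = \sum_(i < n) h i.
  by apply/funext => s; rewrite fct_sumE.
exact: is_derive_sum.
Qed.

Lemma is_derive_mulM w t : is_derive t 1 ( *%R w) w.
Proof. by rewrite -[X in is_derive _ _ _ X]mulr1; exact: is_deriveZ_pt (is_derive_id t 1). Qed.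

Lemma is_derive_cosM w t : is_derive t 1 (fun s => cos (w * s)) (- (w * sin (w * t))).
Proof.
have := is_derive1_comp (is_derive_cos _) (is_derive_mulM w t).
by rewrite mulNr mulrC.
Qed.

Lemma is_derive_sinM w t : is_derive t 1 (fun s => sin (w * s)) (w * cos (w * t)).
Proof.
have := is_derive1_comp (is_derive_sin _) (is_derive_mulM w t).
by rewrite mulrC.
Qed.

Lemma continuous_cosM w : continuous (fun s : R => cos (w * s)).
Proof. exact: is_derive_continuous (is_derive_cosM w). Qed.

Lemma is_derive_expM (c t : R) : is_derive t 1 (fun s => expR (c * s)) (c * expR (c * t)).
Proof.
have := is_derive1_comp (is_derive_expR _) (is_derive_mulM c t).
by rewrite mulrC.
Qed.

Lemma is_derive_LRcontinuous f g (x y : R) :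
  (forall t : R, is_derive t 1 f (g t)) -> derivable_oo_LRcontinuous f x y.
Proof.
move=> df; have cf := is_derive_continuous df.
split=> [t _||]; first by case: (df t).
- by apply: cvg_at_right_filter; exact: cf.
- by apply: cvg_at_left_filter; exact: cf.
Qed.

Lemma is_derive_derive1E f g (t : R) : is_derive t 1 f (g t) -> derive1 f t = g t.
Proof. by move=> df; rewrite derive1E derive_val. Qed.

Lemma Rintegral_is_derive F f T : 0 < T ->
  (forall t : R, is_derive t 1 F (f t)) -> continuous f ->
  \int[lebesgue_measure]_(s in `[0, T]) f s = F T - F 0.
Proof.
move=> T0 dF cf; rewrite /Rintegral (@continuous_FTC2 _ f F)//.
- exact: continuous_subspaceT.
- exact: is_derive_LRcontinuous dF.
- by move=> x _; apply: is_derive_derive1E.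
Qed.

Lemma continuous_integrable_cc f (x y : R) : continuous f ->
  lebesgue_measure.-integrable `[x, y] (EFin \o f).
Proof.
by move=> cf; apply: continuous_compact_integrable;
  [exact: segment_compact|exact: continuous_subspaceT].
Qed.

Lemma lipschitz1 (f df : R -> R) : (forall t : R, is_derive t 1 f (df t)) ->
  (forall t, `|df t| <= 1) -> forall x y, `|f x - f y| <= `|x - y|.
Proof.
move=> hf df1; suff h x y : y <= x -> `|f x - f y| <= `|x - y|.
  move=> x y; case: (leP y x) => [/h//|/ltW/h]; by rewrite distrC [`|y - x|]distrC.
move=> yx; have cf := is_derive_continuous hf.
have [c _ ->] := MVT_segment yx (fun x _ => hf x) (continuous_subspaceT cf).
by rewrite normrM ler_piMl.
Qed.

Lemma lipschitz_cos (x y : R) : `|cos x - cos y| <= `|x - y|.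
Proof.
apply: (lipschitz1 (df := fun t => - sin t)) => t; rewrite ?normrN.
exact: sin_max.
Qed.

Lemma lipschitz_sin (x y : R) : `|sin x - sin y| <= `|x - y|.
Proof. by apply: (lipschitz1 (df := fun t => cos t)) => t; exact: cos_max. Qed.

End Calculus.

(** * Time means *)

Section Mean.
Context {R : realType}.
Implicit Types (f g : R -> R) (T w l : R).

Definition time_mean f T : R :=
  T^-1 * \int[lebesgue_measure]_(s in `[0, T]) f s.

Definition has_mean f l : Prop := time_mean f T @[T --> +oo] --> l.

(** The primitive sin (w s) / w is bounded, so its increments are killed by the
factor 1 / T. *)
Lemma has_mean_cos w : w != 0 -> has_mean (fun s => cos (w * s)) 0.
Proof.
move=> w0; rewrite /has_mean.
have E : \forall T \near +oo, sin (w * T) / w / T = time_mean (fun s => cos (w * s)) T.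
  near=> T; have T0 : 0 < T by near: T; exact: nbhs_pinfty_gt.
  have dF (t : R) : is_derive t 1 (fun s => sin (w * s) / w) (cos (w * t)).
    have -> : (fun s => sin (w * s) / w) = w^-1 *: (fun s => sin (w * s)).
      by apply/funext => s; rewrite mulrC.
    rewrite -[X in is_derive _ _ _ X](mulKf w0).
    exact: is_deriveZ (is_derive_sinM w t).
  rewrite /time_mean (Rintegral_is_derive T0 dF) ?mulr0 ?sin0 ?mul0r ?subr0 1?mulrC//.
  exact: continuous_cosM.
apply: cvg_trans (near_eq_cvg E) _.
apply/cvgrPdist_lt => e e0; near=> T.
have T0 : 0 < T by near: T; exact: nbhs_pinfty_gt.
rewrite sub0r normrN !normrM !normfV (gtr0_norm T0) ltr_pdivrMr//.
apply: (@le_lt_trans _ _ `|w|^-1).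
  by rewrite ler_piMl ?invr_ge0// sin_max.
rewrite mulrC -ltr_pdivrMr//; near: T; apply: nbhs_pinfty_gt; exact: num_real.
Unshelve. all: by end_near. Qed.

Lemma has_mean1 : has_mean (fun=> 1) 1.
Proof.
rewrite /has_mean.
have E : \forall T \near +oo, 1 = time_mean (fun=> 1) T.
  near=> T; have T0 : 0 < T by near: T; exact: nbhs_pinfty_gt.
  rewrite /time_mean Rintegral_cst//= lebesgue_measure_itv/= lte_fin T0 /= mul1r.
  by rewrite oppr0 addr0 mulVf ?gt_eqF.
by apply: cvg_trans (near_eq_cvg E) _; exact: cvg_cst.
Unshelve. all: by end_near. Qed.

Lemma has_meanD f g l m : continuous f -> continuous g ->
  has_mean f l -> has_mean g m -> has_mean (fun s => f s + g s) (l + m).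
Proof.
move=> cf cg fl gm; rewrite /has_mean.
have -> : time_mean (fun s => f s + g s) = (fun T => time_mean f T + time_mean g T).
  apply/funext => T; rewrite /time_mean RintegralD ?mulrDr//;
    exact: continuous_integrable_cc.
exact: cvgD.
Qed.

Lemma has_meanZ c f l : continuous f ->
  has_mean f l -> has_mean (fun s => c * f s) (c * l).
Proof.
move=> cf fl; rewrite /has_mean.
have -> : time_mean (fun s => c * f s) = (fun T => c * time_mean f T).
  apply/funext => T; rewrite /time_mean RintegralZl 1?mulrCA//.
  exact: continuous_integrable_cc.
by apply: cvgM fl; exact: cvg_cst.
Qed.

Lemma has_mean_sum (I : Type) (r : seq I) (F : I -> R -> R) (L : I -> R) :
  (forall i, continuous (F i)) -> (forall i, has_mean (F i) (L i)) ->
  has_mean (fun s => \sum_(i <- r) F i s) (\sum_(i <- r) L i).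
Proof.
move=> cF FL.
suff [] : continuous (fun s => \sum_(i <- r) F i s) /\
  has_mean (fun s => \sum_(i <- r) F i s) (\sum_(i <- r) L i) by [].
elim: r => [|i r [IHc IH]].
  rewrite big_nil; under eq_fun do rewrite big_nil.
  split; first by move=> x; exact: cvg_cst.
  have -> : (fun=> 0) = (fun=> 0 * 1) :> (R -> R) by rewrite mul0r.
  rewrite -[X in has_mean _ X](mul0r 1).
  by apply: has_meanZ has_mean1 => x; exact: cvg_cst.
rewrite big_cons; under eq_fun do rewrite big_cons.
split; first by move=> x; apply: cvgD; [exact: cF|exact: IHc].
exact: has_meanD.
Qed.

Lemma time_mean_dist f g (e T : R) : continuous f -> continuous g ->
  (forall s, `|f s - g s| <= e) -> 0 < T -> `|time_mean f T - time_mean g T| <= e.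
Proof.
move=> cf cg fge T0.
have cfg : continuous (fun s => f s - g s) by move=> x; exact: cvgB (cf x) (cg x).
rewrite /time_mean -mulrBr -RintegralB//; [|exact: continuous_integrable_cc..].
rewrite normrM gtr0_norm ?invr_gt0// ler_pdivrMl//.
apply: le_trans (le_normr_Rintegral _ _) _ => //; first exact: continuous_integrable_cc.
apply: (@le_trans _ _ (\int[lebesgue_measure]_(s in `[0, T]) e)).
  apply: le_Rintegral => //.
  - by apply: continuous_integrable_cc => x; apply: cvg_norm; exact: cfg.
  - by apply: continuous_integrable_cc => x; exact: cvg_cst.
rewrite Rintegral_cst//= lebesgue_measure_itv/= lte_fin T0 /= oppr0 addr0.
by rewrite mulrC.
Qed.

Lemma time_mean_near f g (l e : R) : continuous f -> continuous g -> 0 < e ->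
  (forall s, `|f s - g s| <= e / 2) -> has_mean g l ->
  \forall T \near +oo, `|l - time_mean f T| < e.
Proof.
move=> cf cg e0 fg /cvgrPdist_lt gl.
have {}gl := gl (e / 2) (divr_gt0 e0 (ltr0n _ 2)); near=> T.
have -> : l - time_mean f T = (l - time_mean g T) - (time_mean f T - time_mean g T) by ring.
rewrite (le_lt_trans (ler_normB _ _))// [e]splitr ltr_leD//; first by near: T.
by apply: time_mean_dist => //; near: T; exact: nbhs_pinfty_gt.
Unshelve. all: by end_near. Qed.

Definition unif_approx (C : (R -> R) -> Prop) f : Prop :=
  forall e, 0 < e -> exists2 g, C g & forall s, `|f s - g s| <= e.

(** Time averaging is 1-Lipschitz for the sup norm, so the time means of f form
a Cauchy filter as soon as those of nearby functions converge. *)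
Lemma has_mean_unif_approx (C : (R -> R) -> Prop) f : continuous f ->
  (forall g, C g -> continuous g /\ exists l, has_mean g l) ->
  unif_approx C f -> exists l, has_mean f l.
Proof.
move=> cf CP fC.
suff /cvg_ex[l fl] : cvg (time_mean f T @[T --> +oo]) by exists l.
apply/cauchy_cvgP/cauchy_exP => e e0.
have [g Cg fg] := fC _ (divr_gt0 e0 (ltr0n _ 2)).
have [cg [l gl]] := CP _ Cg; exists l.
by rewrite /fmapE -ball_normE /ball_/=; exact: time_mean_near gl.
Qed.

Lemma has_mean0_unif_approx (C : (R -> R) -> Prop) f : continuous f ->
  (forall g, C g -> continuous g /\ has_mean g 0) ->
  unif_approx C f -> has_mean f 0.
Proof.
move=> cf CP fC; apply/cvgrPdist_lt => e e0.
have [g Cg fg] := fC _ (divr_gt0 e0 (ltr0n _ 2)).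
by have [cg g0] := CP _ Cg; exact: time_mean_near g0.
Qed.

End Mean.

(** * Trigonometric sums *)

Section TrigonometricSums.
Context {R : realType}.
Implicit Types (S : set R) (f g X : R -> R).

(** Real even trigonometric sums with frequencies in S.  Tracking the frequency
set is what allows a parity argument to exclude the frequency 0. *)
Inductive trigsum S : (R -> R) -> Prop :=
| trigsum_cos w : S w -> trigsum S (fun s => cos (w * s))
| trigsumD f g : trigsum S f -> trigsum S g -> trigsum S (fun s => f s + g s)
| trigsumZ c f : trigsum S f -> trigsum S (fun s => c * f s).

Lemma trigsum_continuous S f : trigsum S f -> continuous f.
Proof.
elim=> {f} [w _|f g _ cf _ cg|c f _ cf] x.
- exact: continuous_cosM.
- exact: cvgD (cf x) (cg x).
- by apply: cvgM (cf x); exact: cvg_cst.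
Qed.

Lemma trigsum_bounded S f : trigsum S f -> exists M, forall s, `|f s| <= M.
Proof.
elim=> {f} [w _|f g _ [M fM] _ [L gL]|c f _ [M fM]].
- by exists 1 => s; exact: cos_max.
- by exists (M + L) => s; rewrite (le_trans (ler_normD _ _))// lerD.
- by exists (`|c| * M) => s; rewrite normrM ler_wpM2l.
Qed.

Lemma trigsum_has_mean S f : trigsum S f -> exists l, has_mean f l.
Proof.
elim=> {f} [w _|f g tf [l fl] tg [m gm]|c f tf [l fl]].
- have [->|w0] := eqVneq w 0; last by exists 0; exact: has_mean_cos.
  exists 1; have -> : (fun s => cos (0 * s)) = (fun=> 1) :> (R -> R).
    by apply/funext => s; rewrite mul0r cos0.
  exact: has_mean1.
- by exists (l + m); apply: has_meanD => //;
    [exact: trigsum_continuous tf|exact: trigsum_continuous tg].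
- by exists (c * l); apply: has_meanZ => //; exact: trigsum_continuous tf.
Qed.

Lemma trigsum_has_mean0 S f : ~ S 0 -> trigsum S f -> has_mean f 0.
Proof.
move=> S0; elim=> {f} [w Sw|f g tf f0 tg g0|c f tf f0].
- by apply: has_mean_cos; apply: contra_notN S0 => /eqP <-.
- by rewrite -(addr0 0); apply: has_meanD => //;
    [exact: trigsum_continuous tf|exact: trigsum_continuous tg].
- by rewrite -(mulr0 c); apply: has_meanZ => //; exact: trigsum_continuous tf.
Qed.

Lemma cosMcos (x y : R) : cos x * cos y = 2^-1 * (cos (x + y) + cos (x - y)).
Proof. by rewrite cosD cosB; field. Qed.

(** The product of cosines of frequencies x and y is a sum of cosines of
frequencies x + y and x - y. *)
Lemma trigsumM (S1 S2 S3 : set R) f g :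
  (forall x y, S1 x -> S2 y -> S3 (x + y) /\ S3 (x - y)) ->
  trigsum S1 f -> trigsum S2 g -> trigsum S3 (fun s => f s * g s).
Proof.
move=> S123 tf tg; elim: tf => {f} [w Sw|f f' _ tf _ tf'|c f _ tf].
- elim: tg => {g} [v Sv|g g' _ tg _ tg'|c g _ tg].
  + have [Sp Sm] := S123 _ _ Sw Sv.
    under eq_fun do rewrite cosMcos -mulrDl -mulrBl.
    by apply: trigsumZ; apply: trigsumD; exact: trigsum_cos.
  + by under eq_fun do rewrite mulrDr; exact: trigsumD.
  + by under eq_fun do rewrite mulrCA; exact: trigsumZ.
- by under eq_fun do rewrite mulrDl; exact: trigsumD.
- by under eq_fun do rewrite -mulrA; exact: trigsumZ.
Qed.

(** The classical iteration for the square root of x ^ 2.  Starting at 0, it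
produces polynomials in x ^ 2 that increase to |x| on [-1, 1]. *)
Fixpoint abs_approx (n : nat) (x : R) : R :=
  if n is m.+1 then abs_approx m x + 2^-1 * (x ^+ 2 - abs_approx m x ^+ 2) else 0.

(** With a = |x| and e_n the error after n steps, e_(n+1) = e_n * (1 - (a + p_n) / 2)
where 0 <= p_n <= a, and e_n * (2 + n * a) <= 2 * a is preserved: the factor is at
most 1 - a / 2, while 2 + n * a grows by a.  Dividing by a gives an error of at
most 2 / n, uniformly in x. *)
Lemma abs_approxP (n : nat) (x : R) : `|x| <= 1 ->
  `| `|x| - abs_approx n x | * n%:R <= 2.
Proof.
set a := `|x|; have a0 : 0 <= a by exact: normr_ge0.
have -> : abs_approx n x = abs_approx n a.
  by elim: n => //= n ->; rewrite /a real_normK// num_real.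
move=> a1.
suff [p0 pa h] : [/\ 0 <= abs_approx n a, abs_approx n a <= a &
    (a - abs_approx n a) * (2 + n%:R * a) <= 2 * a].
  rewrite ger0_norm ?subr_ge0//; move: h; set p := abs_approx n a in p0 pa *.
  have n0 : 0 <= n%:R :> R by [].
  have [->|an0] := eqVneq a 0; first by nra.
  have {an0} a_gt0 : 0 < a by rewrite lt_def an0.
  move=> h; rewrite -(ler_pM2r a_gt0); nra.
elim: n => [|n [p0 pa h]] /=; first by split=> //; lra.
set p := abs_approx n a in p0 pa h *.
have n0 : 0 <= n%:R :> R by [].
have -> : n.+1%:R = n%:R + 1 :> R by rewrite -natr1.
split; [nra|nra|].
apply: le_trans h.
have -> : a - (p + 2^-1 * (a ^+ 2 - p ^+ 2)) = (a - p) * (1 - (a + p) / 2) by field.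
rewrite -mulrA; apply: ler_wpM2l; first by rewrite subr_ge0.
have na0 : 0 <= n%:R * a by rewrite mulr_ge0.
nra.
Qed.

(** [abs_approx] applied to X / M, where M bounds |X|, only involves sums and
products of X ^ 2, so its frequencies stay in the subgroup S. *)
Lemma trigsum_abs_approx S X : S !=set0 ->
  (forall x y, S x -> S y -> S (x + y) /\ S (x - y)) ->
  trigsum S (fun s => X s ^+ 2) -> (exists M, forall s, `|X s| <= M) ->
  unif_approx (trigsum S) (fun s => `|X s|).
Proof.
move=> [w0 Sw0] SS tX [M0 XM0] e e0.
pose M := Num.max 1 M0.
have M1 : 1 <= M by rewrite le_max lexx.
have M_gt0 : 0 < M by rewrite (lt_le_trans _ M1).
have XM s : `|X s / M| <= 1.
  rewrite normrM normfV (gtr0_norm M_gt0) ler_pdivrMr// mul1r (le_trans (XM0 s))//.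
  by rewrite le_max lexx orbT.
have tA n : trigsum S (fun s => abs_approx n (X s / M)).
  elim: n => [|n IH] /=.
    have -> : (fun=> 0) = (fun s => 0 * cos (w0 * s)).
      by apply/funext => s; rewrite mul0r.
    by apply: trigsumZ; exact: trigsum_cos.
  apply: trigsumD => //; apply: trigsumZ.
  have -> : (fun s => (X s / M) ^+ 2 - abs_approx n (X s / M) ^+ 2) =
    (fun s => M ^- 2 * X s ^+ 2 + (-1) * (abs_approx n (X s / M) * abs_approx n (X s / M))).
    by apply/funext => s; rewrite expr_div_n mulN1r expr2 mulrC.
  by apply: trigsumD; apply: trigsumZ => //; exact: (trigsumM SS).
have [n ne] : exists n : nat, 2 * M / e < n.+1%:R.
  exists (Num.truncn (2 * M / e)); exact: truncnS_gt.
exists (fun s => M * abs_approx n.+1 (X s / M)); first exact: trigsumZ.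
move=> s; have := abs_approxP n.+1 (XM s).
set p := abs_approx _ _; set q := n.+1%:R => pq.
have -> : `|X s| - M * p = M * (`|X s / M| - p).
  by rewrite normrM normfV (gtr0_norm M_gt0) mulrBr mulrCA mulfV ?mulr1// gt_eqF.
rewrite normrM (gtr0_norm M_gt0).
have q0 : 0 < q by rewrite ltr0n.
rewrite -(ler_pM2r q0).
rewrite ltr_pdivrMr// in ne.
rewrite -mulrA (le_trans (ler_wpM2l (ltW M_gt0) pq))// mulrC [e * q]mulrC; exact: ltW.
Qed.

End TrigonometricSums.

(** * Means of rectified trigonometric sums *)

Lemma pos_partE {R : realType} (x : R) : pos_part x = 2^-1 * (x + `|x|).
Proof. by rewrite /pos_part; case: ler0P => h; field. Qed.

Lemma continuous_pos_part {R : realType} : continuous (@pos_part R).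
Proof.
move=> x; have -> : @pos_part R = (fun y => 2^-1 * (y + `|y|)).
  by apply/funext => y; exact: pos_partE.
by apply: cvgM; [exact: cvg_cst|apply: cvgD; [|apply: cvg_norm]; exact: cvg_id].
Qed.

Section RectifiedMeans.
Context {R : realType}.
Implicit Types (S : set R) (f g X : R -> R).

Lemma trigsum_sum S (I : Type) (r : seq I) (F : I -> R -> R) : S !=set0 ->
  (forall i, trigsum S (F i)) -> trigsum S (fun s => \sum_(i <- r) F i s).
Proof.
move=> [w Sw] tF; elim: r => [|i r IH].
  have -> : (fun s => \sum_(i <- [::]) F i s) = (fun s => 0 * cos (w * s)).
    by apply/funext => s; rewrite big_nil mul0r.
  by apply: trigsumZ; exact: trigsum_cos.
under eq_fun do rewrite big_cons.
exact: trigsumD.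
Qed.

Lemma trigsum_unif_approxMcos S1 S2 f (w : R) :
  (forall x, S1 x -> S2 (x + w) /\ S2 (x - w)) ->
  unif_approx (trigsum S1) f -> unif_approx (trigsum S2) (fun s => f s * cos (w * s)).
Proof.
move=> S12 fS e e0; have [g tg fg] := fS _ e0.
exists (fun s => g s * cos (w * s)).
  apply: (@trigsumM _ S1 [set w]) => //; last exact: trigsum_cos.
  by move=> x _ Sx ->; exact: S12.
move=> s; rewrite -mulrBl normrM -[e]mulr1.
by apply: ler_pM => //; exact: cos_max.
Qed.

Lemma continuous_absMcos X (w : R) : continuous X -> continuous (fun s => `|X s| * cos (w * s)).
Proof.
move=> cX s; apply: cvgM; first exact: cvg_norm (cX s).
exact: continuous_cosM.
Qed.

Lemma continuousMcos X (w : R) : continuous X -> continuous (fun s => X s * cos (w * s)).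
Proof.
move=> cX s; apply: cvgM; first exact: cX.
exact: continuous_cosM.
Qed.

Lemma has_mean_pos_part X (w l m : R) : continuous X ->
  has_mean (fun s => X s * cos (w * s)) l ->
  has_mean (fun s => `|X s| * cos (w * s)) m ->
  has_mean (fun s => pos_part (X s) * cos (w * s)) (2^-1 * (l + m)).
Proof.
move=> cX Xl Xm.
have -> : (fun s => pos_part (X s) * cos (w * s)) =
    (fun s => 2^-1 * (X s * cos (w * s) + `|X s| * cos (w * s))).
  by apply/funext => s; rewrite pos_partE -mulrA mulrDl.
have cXw := continuousMcos (w := w) cX; have caX := continuous_absMcos (w := w) cX.
apply: has_meanZ; last exact: has_meanD.
by move=> s; exact: cvgD (cXw s) (caX s).
Qed.

(** All frequencies are allowed here, so that X may have a constant term. *)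
Lemma trigsum_pos_part_has_mean X (w : R) : trigsum setT X ->
  exists l, has_mean (fun s => pos_part (X s) * cos (w * s)) l.
Proof.
move=> tX; have cX := trigsum_continuous tX.
have tw : trigsum setT (fun s : R => cos (w * s)) by exact: trigsum_cos.
have [l Xl] : exists l, has_mean (fun s => X s * cos (w * s)) l.
  by apply: (@trigsum_has_mean _ setT); exact: (@trigsumM _ setT setT).
have [m Xm] : exists m, has_mean (fun s => `|X s| * cos (w * s)) m.
  apply: (@has_mean_unif_approx _ (trigsum setT)).
  - exact: continuous_absMcos.
  - by move=> g tg; split; [exact: trigsum_continuous tg|exact: trigsum_has_mean tg].
  - apply: (@trigsum_unif_approxMcos setT) => //.
    apply: trigsum_abs_approx => //; first by exists 0.
      exact: (@trigsumM _ setT setT).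
    exact: trigsum_bounded tX.
by exists (2^-1 * (l + m)); exact: has_mean_pos_part.
Qed.

(** The integer combinations of the om j whose coefficient sum has the parity
of c: a group for c = 0, and its coset containing every om j for c = 1. *)
Definition parity_freqs (N : nat) (om : 'I_N -> R) (c : int) : set R :=
  [set x | exists n : 'I_N -> int, exists m : int,
    x = \sum_j (n j)%:~R * om j /\ \sum_j n j = m * 2 + c].

Lemma parity_freqsD N (om : 'I_N -> R) (c c' : int) (x y : R) :
  parity_freqs om c x -> parity_freqs om c' y -> parity_freqs om (c + c') (x + y).
Proof.
move=> [n [m [-> nm]]] [n' [m' [-> nm']]].
exists (fun j => n j + n' j), (m + m'); split.
  by rewrite -big_split /=; apply: eq_bigr => j _; rewrite rmorphD mulrDl.
by rewrite big_split/= nm nm'; ring.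
Qed.

Lemma parity_freqsN N (om : 'I_N -> R) (c : int) (x : R) :
  parity_freqs om c x -> parity_freqs om (- c) (- x).
Proof.
move=> [n [m [-> nm]]]; exists (fun j => - n j), (- m); split.
  by rewrite -sumrN /=; apply: eq_bigr => j _; rewrite rmorphN mulNr.
by rewrite sumrN nm; ring.
Qed.

Lemma parity_freqs_shift N (om : 'I_N -> R) (c c' p : int) (x : R) :
  c' = c + p * 2 -> parity_freqs om c x -> parity_freqs om c' x.
Proof.
by move=> -> [n [m [-> nm]]]; exists n, (m - p); split; rewrite // nm; ring.
Qed.

Lemma parity_freqs1 N (om : 'I_N -> R) (k : 'I_N) : parity_freqs om 1 (om k).
Proof.
exists (fun j => (j == k)%:R), 0; split.
  rewrite (bigD1 k)//= eqxx mul1r big1 ?addr0// => j /negPf ->.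
  by rewrite mul0r.
by rewrite (bigD1 k)//= eqxx big1 ?addr0 ?mul0r ?add0r// => j /negPf ->.
Qed.

(** Linear independence forces the coefficients of a vanishing combination to be
0, whose sum is even. *)
Lemma lin_indep_int_freqs N (om : 'I_N -> R) :
  lin_indep_int om -> ~ parity_freqs om 1 0.
Proof.
move=> li [n [m [/esym/li n0 nm]]].
by move: nm; rewrite big1// => nm; lia.
Qed.

Lemma lin_indep_int_scale N (lam : 'I_N -> R) (c : R) : c != 0 ->
  lin_indep_int lam -> lin_indep_int (fun j => lam j / c).
Proof.
move=> c0 li n nl; apply: li.
rewrite -[LHS](mulfVK c0) mulr_suml -[RHS](mul0r c); congr (_ * _).
by rewrite -[RHS]nl; apply: eq_bigr => j _; rewrite mulrA.
Qed.

(** In X cos (om k s) only the term j = k is resonant: om j + om k never vanishes,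
and om j - om k vanishes only for j = k.  For |X| cos (om k s), the approximations
of |X| have even frequencies, which become odd, hence nonzero, after the product
with cos (om k s). *)
Lemma has_mean_pos_part_indep N (om c : 'I_N -> R) (k : 'I_N) :
  lin_indep_int om ->
  has_mean (fun s => pos_part (\sum_j c j * cos (om j * s)) * cos (om k * s)) (c k / 4).
Proof.
move=> li; have om0 := lin_indep_int_freqs li.
set X := fun s => \sum_j c j * cos (om j * s).
have tX : trigsum (parity_freqs om 1) X.
  apply: trigsum_sum; first by exists (om k); exact: parity_freqs1.
  by move=> j; apply/trigsumZ/trigsum_cos; exact: parity_freqs1.
have cX := trigsum_continuous tX.
have -> : c k / 4 = 2^-1 * (c k / 2 + 0) by field.
apply: has_mean_pos_part => //.
- have -> : (fun s => X s * cos (om k * s)) = (fun s => \sum_j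
     (c j / 2) * (cos ((om j + om k) * s) + cos ((om j - om k) * s))).
    apply/funext => s; rewrite /X mulr_suml; apply: eq_bigr => j _.
    by rewrite -mulrA cosMcos mulrDl mulrBl; ring.
  have -> : c k / 2 = \sum_j (c j / 2) * (0 + (j == k)%:R).
    rewrite (bigD1 k)//= eqxx add0r mulr1 big1 ?addr0// => j /negPf ->.
    by rewrite addr0 mulr0.
  have cc w : continuous (fun s : R => cos (w * s)) := @continuous_cosM R w.
  apply: has_mean_sum => j.
    move=> s; apply: cvgM; first exact: cvg_cst.
    by apply: cvgD; exact: cc.
  apply: has_meanZ; first by move=> s; apply: cvgD; exact: cc.
  apply: has_meanD => //.
    apply: has_mean_cos; apply/eqP => jk0.
    (* the coefficient of om k is 1, or 2 when j = k *)
    have /li/(_ k) : \sum_i ((i == j)%:R + (i == k)%:R : int)%:~R * om i = 0.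
      under eq_bigr do rewrite rmorphD mulrDl.
      rewrite big_split/= -[RHS]jk0; congr (_ + _).
        by rewrite (bigD1 j)//= eqxx mul1r big1 ?addr0// => i /negPf ->; rewrite mul0r.
      by rewrite (bigD1 k)//= eqxx mul1r big1 ?addr0// => i /negPf ->; rewrite mul0r.
    by rewrite eqxx; case: eqP.
  have [->|jk] := eqVneq j k.
    have -> : (fun s => cos ((om k - om k) * s)) = (fun=> 1) :> (R -> R).
      by apply/funext => s; rewrite subrr mul0r cos0.
    exact: has_mean1.
  apply: has_mean_cos; apply/eqP => jk0.
  have /li/(_ j) : \sum_i ((i == j)%:R - (i == k)%:R : int)%:~R * om i = 0.
    under eq_bigr do rewrite rmorphB mulrBl.
    rewrite sumrB/= -[RHS]jk0; congr (_ - _).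
      by rewrite (bigD1 j)//= eqxx mul1r big1 ?addr0// => i /negPf ->; rewrite mul0r.
    by rewrite (bigD1 k)//= eqxx mul1r big1 ?addr0// => i /negPf ->; rewrite mul0r.
  by rewrite eqxx (negPf jk).
- apply: (@has_mean0_unif_approx _ (trigsum (parity_freqs om 1))).
  + exact: continuous_absMcos.
  + by move=> g tg; split; [exact: trigsum_continuous tg|exact: trigsum_has_mean0 tg].
  + apply: (@trigsum_unif_approxMcos (parity_freqs om 0)).
      move=> x Sx; split.
        by rewrite -(add0r (1 : int)); apply: parity_freqsD => //; exact: parity_freqs1.
      apply: (@parity_freqs_shift _ _ (0 - 1) _ 1) => //; apply: parity_freqsD => //.
      by apply: parity_freqsN; exact: parity_freqs1.
    apply: trigsum_abs_approx => //; last exact: trigsum_bounded tX.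
    * by exists 0; exists (fun=> 0), 0; split; rewrite ?big1// => j _; rewrite mul0r.
    * move=> x y Sx Sy; split; first exact: (parity_freqsD Sx Sy).
      exact: (parity_freqsD Sx (parity_freqsN Sy)).
    * apply: (@trigsumM _ (parity_freqs om 1) (parity_freqs om 1)) => //.
      move=> x y Sx Sy; split; last exact: (parity_freqsD Sx (parity_freqsN Sy)).
      by apply: (@parity_freqs_shift _ _ (1 + 1) _ (-1)) => //; exact: parity_freqsD.
Qed.

End RectifiedMeans.

(** * Differential inequalities *)

Section DifferentialInequalities.
Context {R : realType}.

(** [E s * exp (- c s)] is nonincreasing. *)
Lemma gronwall (E dE : R -> R) (c T : R) : (forall t : R, is_derive t 1 E (dE t)) ->
  (forall t, 0 < t < T -> dE t <= c * E t) ->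
  forall t, 0 <= t <= T -> E t <= E 0 * expR (c * t).
Proof.
move=> hE hle t /andP[t0 tT].
pose h s := E s * expR (- c * s).
have dh (s : R) : is_derive s 1 h (dE s * expR (- c * s) + E s * (- c * expR (- c * s))).
  exact: is_deriveM_pt (hE s) (is_derive_expM _ _).
have : h t <= h 0.
  apply: (@ler0_derive1_le_cc R h 0 T) => //; rewrite ?in_itv/= ?lexx ?t0 ?tT ?(le_trans t0)//.
  - move=> x; rewrite in_itv/= => x0T.
    rewrite derive1E (@derive_val _ _ _ _ _ _ _ (dh x)).
    have -> : dE x * expR (- c * x) + E x * (- c * expR (- c * x)) =
      (dE x - c * E x) * expR (- c * x) by ring.
    by rewrite mulr_le0_ge0 ?expR_ge0// subr_le0 hle.
  - by apply: continuous_subspaceT; exact: (is_derive_continuous dh).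
rewrite /h mulr0 expR0 mulr1 mulNr expRN ler_pdivrMr// expR_gt0//.
Qed.

(** The energy G = dw ^ 2 + om ^ 2 w ^ 2 satisfies G' = 2 eps g dw, and
2 |dw| <= 1 + dw ^ 2 turns this into Gronwall's inequality for 1 + G. *)
Lemma oscillator_estimate (w dw g : R -> R) (om eps M T : R) : 0 <= eps ->
  (forall t : R, is_derive t 1 w (dw t)) ->
  (forall t : R, is_derive t 1 dw (eps * g t - om ^+ 2 * w t)) ->
  w 0 = 0 -> dw 0 = 0 ->
  (forall t, 0 <= t <= T -> `|g t| <= M) ->
  forall t, 0 <= t <= T -> dw t ^+ 2 + om ^+ 2 * w t ^+ 2 <= expR (eps * M * t) - 1.
Proof.
move=> e0 hw hdw w0 dw0 gM t tT.
pose G s := dw s ^+ 2 + om ^+ 2 * w s ^+ 2.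
have dG (s : R) : is_derive s 1 (fun s => 1 + G s) (2 * eps * dw s * g s).
  have -> : 2 * eps * dw s * g s = (2 * dw s * (eps * g s - om ^+ 2 * w s) +
      om ^+ 2 * (2 * w s * dw s)) by ring.
  apply: is_derive_cstD_pt.
  apply: is_deriveD_pt; first exact: is_derive_sqr_pt.
  by apply/is_deriveZ_pt/is_derive_sqr_pt.
have := @gronwall _ _ (eps * M) T dG _ t tT.
have -> : G 0 = 0 by rewrite /G w0 dw0 expr0n/= mulr0 addr0.
rewrite addr0 mul1r -/(G t) => h.
rewrite lerBrDl; apply: h => s /andP[s0 sT].
have := gM s; rewrite (ltW s0) (ltW sT) => /(_ isT) gs.
have -> : 2 * eps * dw s * g s = eps * (2 * dw s * g s) by ring.
rewrite -[eps * M * _]mulrA; apply: ler_wpM2l => //.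
have M0 : 0 <= M by apply: le_trans gs.
have G1 : 1 + dw s ^+ 2 <= 1 + G s by rewrite lerD2l lerDl mulr_ge0// sqr_ge0.
apply: le_trans (ler_wpM2l M0 G1).
apply: le_trans (ler_norm _) _; rewrite !normrM ger0_norm//.
apply: (@le_trans _ _ (2 * `|dw s| * M)); first by apply: ler_wpM2l => //; rewrite mulr_ge0.
rewrite mulrC; apply: ler_wpM2l => //.
rewrite -(real_normK (num_real (dw s))).
by have := sqr_ge0 (1 - `|dw s|); nra.
Qed.

End DifferentialInequalities.

(** * Reflection of solutions given on the half line *)

Section Reflection.
Context {R : realType}.
Implicit Types (f g : R -> R) (t : R).

Lemma is_deriveP f t l :
  (h^-1 * (f (t + h) - f t)) @[h --> 0^'] --> l <-> is_derive t 1 f l.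
Proof.
have -> : (fun h : R => h^-1 * (f (t + h) - f t)) =
  (fun h => h^-1 *: ((f \o shift t) (h *: 1) - f t)).
  by apply/funext => h /=; rewrite /GRing.scale/= mulr1 [h + t]addrC.
split=> [fl|[df fl]].
  by apply: DeriveDef; [apply/cvg_ex; exists l|exact: cvg_lim fl].
by rewrite -fl; exact: df.
Qed.

Lemma has_deriv_nneg_is_derive f t l : 0 < t ->
  has_deriv_nneg f t l -> is_derive t 1 f l.
Proof.
move=> t0 H; apply/is_deriveP => A /H HA.
have D : \forall h \near 0^', 0 <= t + h.
  near=> h; have : `|h| < t by near: h; exact: (@dnbhs0_lt _ R).
  by rewrite ltr_norml => /andP[h1 _]; rewrite ltW// -ltrBlDl sub0r.
by apply: filterS2 D HA => h Dh; apply.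
Unshelve. all: by end_near. Qed.

Lemma cvg_norm_within0 :
  (`|h| : R) @[h --> (0 : R)^'] --> within [set h : R | 0 <= 0 + h] 0^'.
Proof.
move=> A /nbhs_ballP[e /= e0 eA]; apply/nbhs_ballP; exists e => //= h he h0.
apply: eA; rewrite /= ?normr_eq0// ?add0r//.
by move: he; rewrite /ball/= !sub0r !normrN normr_id.
Qed.

Lemma has_deriv_nneg0 f l : has_deriv_nneg f 0 l ->
  (`|h|^-1 * (f `|h| - f 0)) @[h --> (0 : R)^'] --> l.
Proof.
move=> H; have := cvg_comp _ _ cvg_norm_within0 H.
have -> // : (fun h : R => h^-1 * (f (0 + h) - f 0)) \o Num.norm =
  (fun h : R => `|h|^-1 * (f `|h| - f 0)).
by apply/funext => h /=; rewrite add0r.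
Qed.

Lemma is_derive_reflect f t d : is_derive (- t) 1 f d ->
  is_derive t 1 (fun s => f (- s)) (- d).
Proof.
move=> hf; have := @is_derive1_comp R f -%R t d (- 1) hf (is_deriveNid _ _).
by rewrite mulrN1.
Qed.

(** At 0 the two one-sided difference quotients of the extension have opposite
limits, and [g 0 = 0] makes both vanish. *)
Lemma is_derive_even_ext f g t : g 0 = 0 ->
  (forall t, 0 <= t -> has_deriv_nneg f t (g t)) ->
  is_derive t 1 (fun s => f `|s|) (Num.sg t * g `|t|).
Proof.
move=> g0 hf; have [t0|t0|->] := ltgtP t 0.
- rewrite ltr0_sg// ltr0_norm// mulN1r.
  have t0' : 0 < - t by rewrite oppr_gt0.
  apply: (@near_eq_is_derive _ _ _ (fun s => f (- s))).
    near=> s; rewrite ltr0_norm//; near: s.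
    exact: lt_nbhsl.
  by apply/is_derive_reflect/has_deriv_nneg_is_derive => //; apply: hf; exact: ltW.
- rewrite gtr0_sg// gtr0_norm// mul1r.
  apply: (@near_eq_is_derive _ _ _ f).
    near=> s; rewrite gtr0_norm//; near: s.
    exact: lt_nbhsr.
  by apply/has_deriv_nneg_is_derive => //; apply: hf; exact: ltW.
- rewrite sgr0 mul0r; apply/is_deriveP.
  have := has_deriv_nneg0 (hf 0 (lexx 0)); rewrite g0 => /cvg_norm.
  rewrite normr0 => H; apply: norm_cvg0.
  apply: cvg_trans H; apply: near_eq_cvg; near=> h.
  by rewrite /= add0r !normrM !normfV normr_id.
Unshelve. all: by end_near. Qed.

(** Since [f 0 = 0], the difference quotient of the extension at 0 is the even
extension of the right difference quotient of f. *)
Lemma is_derive_odd_ext f g t : f 0 = 0 ->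
  (forall t, 0 <= t -> has_deriv_nneg f t (g t)) ->
  is_derive t 1 (fun s => Num.sg s * f `|s|) (g `|t|).
Proof.
move=> f0 hf; have [t0|t0|->] := ltgtP t 0.
- rewrite ltr0_norm//.
  have t0' : 0 < - t by rewrite oppr_gt0.
  apply: (@near_eq_is_derive _ _ _ (fun s => - f (- s))).
    near=> s; have s0 : s < 0 by near: s; exact: lt_nbhsl.
    by rewrite ltr0_norm// ltr0_sg// mulN1r.
  rewrite -[g _]opprK; apply: is_deriveN.
  by apply/is_derive_reflect/has_deriv_nneg_is_derive => //; apply: hf; exact: ltW.
- rewrite gtr0_norm//.
  apply: (@near_eq_is_derive _ _ _ f).
    near=> s; have s0 : 0 < s by near: s; exact: lt_nbhsr.
    by rewrite gtr0_norm// gtr0_sg// mul1r.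
  by apply/has_deriv_nneg_is_derive => //; apply: hf; exact: ltW.
- rewrite normr0; apply/is_deriveP.
  have := has_deriv_nneg0 (hf 0 (lexx 0)); apply: cvg_trans.
  apply: near_eq_cvg; near=> h.
  have h0 : h != 0 by near: h; exact: nbhs_dnbhs_neq.
  rewrite /= add0r normr0 sgr0 mul0r f0 !subr0 mulrA; congr (_ * _).
  by apply: (@mulIf _ `|h|); rewrite ?normr_eq0// mulVf ?normr_eq0// -mulrA -numEsg mulVf.
Unshelve. all: by end_near. Qed.

End Reflection.

(** * The Sobolev norm of a twice differentiable function *)

Section SobolevNorm.
Context {R : realType}.
Implicit Types (f g h phi : R -> R) (T : R) (D : set R).

Lemma sobolev_inf_norm_ge0 m D f : (0 <= sobolev_inf_norm m D f)%E.
Proof.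
apply: le_ereal_inf_tmp => _ /= [g _ <-]; apply: sume_ge0 => i _.
exact: Lnorm_ge0.
Qed.

Lemma Lnorm_infty_restrict_le D f (r : R) : 0 <= r -> (forall t, D t -> `|f t| <= r) ->
  ('N[lebesgue_measure]_+oo[EFin \o (f \_ D)] <= r%:E)%E.
Proof.
move=> r0 fr; rewrite unlock; case: ifPn => [mu0|_]; last by rewrite lee_fin.
apply/ess_supP; apply: nearW => x /=; rewrite lee_fin patchE.
by case: ifPn => [/set_mem/fr//|_]; rewrite normr0.
Qed.

Lemma continuous_integrable_oo f T : continuous f ->
  lebesgue_measure.-integrable `]0, T[ (EFin \o f).
Proof.
move=> cf; apply: integrableS (continuous_integrable_cc 0 T cf) => //.
exact: subset_itv_oo_cc.
Qed.

Lemma continuous_Rintegral_oo_cc f T : continuous f ->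
  \int[lebesgue_measure]_(x in `]0, T[) f x = \int[lebesgue_measure]_(x in `[0, T]) f x.
Proof.
move=> cf; rewrite Rintegral_itv_obnd_cbnd; last exact: continuous_integrable_oo.
rewrite Rintegral_itv_bndo_bndc//.
apply: integrableS (continuous_integrable_cc 0 T cf) => //.
by apply: subset_itvl; rewrite bnd_simp.
Qed.

(** The complement of K is open, so phi vanishes near each of its points and so
do all its derivatives. *)
Lemma test_function_off_support (K : set R) phi n (x : R) : closed K ->
  (forall x, ~ K x -> phi x = 0) -> ~ K x -> derive1n n phi x = 0.
Proof.
move=> cK phi0; elim: n x => [|n IH] x Kx; first exact: phi0.
rewrite /= derive1E (@near_eq_derive _ _ _ _ (cst 0)); first by rewrite derive_cst.
have : \near x, (~` K) x by apply: open_nbhs_nbhs; split => //; exact: closed_openC.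
by apply: filterS => y; exact: IH.
Qed.

(** The boundary terms vanish because 0 and T lie outside the support of phi. *)
Lemma Rintegral_by_parts_test F f phi T n : 0 < T ->
  (forall t : R, is_derive t 1 F (f t)) -> continuous f ->
  test_function `]0, T[ phi ->
  \int[lebesgue_measure]_(x in `]0, T[) (F x * derive1n n.+1 phi x) =
  - \int[lebesgue_measure]_(x in `]0, T[) (f x * derive1n n phi x).
Proof.
move=> T0 dF cf [dphi [K [cK KT phi0]]].
have clK : closed K by apply: compact_closed cK; exact: Rhausdorff.
have dphi_is m (x : R) : is_derive x 1 (derive1n m phi) (derive1n m.+1 phi x).
  by rewrite /= derive1E; apply: derivableP; exact: dphi.
have cphi m : continuous (derive1n m phi) := is_derive_continuous (dphi_is m).
have off x : ~ `]0, T[%classic x -> derive1n n phi x = 0.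
  by move=> xT; apply: (test_function_off_support _ clK phi0) => /KT.
have cF := is_derive_continuous dF.
rewrite !continuous_Rintegral_oo_cc; [|by move=> x; apply: cvgM; [exact: cf|exact: cphi]
  |by move=> x; apply: cvgM; [exact: cF|exact: cphi]].
rewrite (@Rintegration_by_parts _ F (derive1n n phi) f)//.
- rewrite !off ?mulr0 ?subr0 ?sub0r//= in_itv/= ltxx ?andbF//.
- exact: continuous_subspaceT.
- exact: (is_derive_LRcontinuous _ _ dF).
- by move=> x _; exact: is_derive_derive1E.
- apply: continuous_subspaceT; exact: cphi.
- exact: (is_derive_LRcontinuous _ _ (dphi_is n)).
Qed.

Lemma sobolev_inf_norm2_le h f f1 f2 T (r0 r1 r2 : R) : 0 < T ->
  (forall t : R, is_derive t 1 f (f1 t)) -> (forall t : R, is_derive t 1 f1 (f2 t)) ->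
  continuous f2 -> (forall t, `]0, T[%classic t -> h t = f t) ->
  (forall t, `]0, T[%classic t -> [/\ `|f t| <= r0, `|f1 t| <= r1 & `|f2 t| <= r2]) ->
  (sobolev_inf_norm 2 `]0%R, T[ h <= (r0 + r1 + r2)%:E)%E.
Proof.
move=> T0 df df1 cf2 hf bnd.
have cf := is_derive_continuous df; have cf1 := is_derive_continuous df1.
have loc g : continuous g -> locally_integrable `]0, T[ g.
  by move=> cg; apply: open_integrable_locally;
    [exact: interval_open|exact: continuous_integrable_oo].
have loch : locally_integrable `]0, T[ h.
  apply: open_integrable_locally; first exact: interval_open.
  apply: eq_integrable (continuous_integrable_oo T cf) => //.
  by move=> x /set_mem/hf /= ->.
have [r00 r10 r20] : [/\ 0 <= r0, 0 <= r1 & 0 <= r2].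
  have [|b0 b1 b2] := bnd (T / 2); first by rewrite /= in_itv/=; apply/andP; split; lra.
  by split; [exact: le_trans b0|exact: le_trans b1|exact: le_trans b2].
have hE phi : \int[lebesgue_measure]_(x in `]0, T[) (h x * phi x) =
    \int[lebesgue_measure]_(x in `]0, T[) (f x * phi x).
  by apply: eq_Rintegral => x /set_mem /hf ->.
pose g (i : nat) := if i is 0%N then f else if i is 1%N then f1 else f2.
have gw i : (i <= 2)%N -> is_weak_deriv `]0, T[ i h (g i).
  case: i => [|[|[|//]]] _; split => //; try exact: loc; move=> phi tphi; rewrite hE.
  - by rewrite expr0 mul1r.
  - by rewrite (Rintegral_by_parts_test _ T0 df)// expr1 mulN1r.
  - rewrite (Rintegral_by_parts_test _ T0 df)// (Rintegral_by_parts_test _ T0 df1)//.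
    by rewrite opprK sqrrN expr1n mul1r.
pose D : set R := `]0, T[%classic.
apply: (@le_trans _ _ (\sum_(i < 3) 'N[lebesgue_measure]_+oo[EFin \o (g i \_ D)])%E).
  by apply: ereal_inf_lbound; exists g.
rewrite !big_ord_recr big_ord0/= add0e !EFinD.
by apply: leeD; [apply: leeD|]; apply: Lnorm_infty_restrict_le => // t /bnd[].
Qed.

End SobolevNorm.

(** * A priori bound on the force *)

Section PerturbedSystem.
Context {R : realType} {N : nat} {lambda : 'I_N -> R} {A : 'M[R]_N} {b a : 'I_N -> R}.
Context (lambda_gt0 : forall k, 0 < lambda k).

Definition unilateral_force (U : 'I_N -> R -> R) (k : 'I_N) (t : R) : R :=
  pos_part (\sum_(j < N) A k j * U j t - b k).

Definition global_solution (eps : R) (U dU : 'I_N -> R -> R) : Prop :=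
  forall k, [/\ U k 0 = a k, dU k 0 = 0, forall t : R, is_derive t 1 (U k) (dU k t) &
    forall t : R, is_derive t 1 (dU k)
      (- eps * unilateral_force U k t - lambda k ^+ 2 * U k t)].

(** A solution with zero initial velocity extends evenly to a solution on the
whole line, since the equation is autonomous and invariant under time reversal.
This removes the one-sided derivatives at 0 from all later estimates. *)
Lemma is_solution_extend eps u : is_solution lambda A b a eps u ->
  exists U dU, global_solution eps U dU /\ forall k t, 0 <= t -> U k t = u k t.
Proof.
move=> [du Hu]; exists (fun k t => u k `|t|), (fun k t => Num.sg t * du k `|t|).
split=> [k|k t t0]; last by rewrite ger0_norm.
have [uk0 duk0 H] := Hu k; split.
- by rewrite normr0.
- by rewrite sgr0 mul0r.
- by move=> t; apply: is_derive_even_ext => // s s0; case: (H s s0).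
- move=> t; apply: (@is_derive_odd_ext _ (du k) (fun s => - eps *
     pos_part (\sum_(j < N) A k j * u j s - b k) - lambda k ^+ 2 * u k s)) => // s s0.
  by case: (H s s0).
Qed.

(** The summand 1 makes the square root of the energy bound the constants b k
as well as the positions and velocities. *)
Let energy (U dU : 'I_N -> R -> R) (t : R) : R :=
  1 + \sum_k (dU k t ^+ 2 + lambda k ^+ 2 * U k t ^+ 2).

(** Since |U j| is at most the square root s of the energy divided by lambda j,
and 1 <= s, the force is at most this constant times s. *)
Let gain (k : 'I_N) : R := \sum_j `|A k j| / lambda j + `|b k|.

Let gain_ge0 k : 0 <= gain k.
Proof. by rewrite addr_ge0// sumr_ge0// => j _; rewrite divr_ge0// ltW. Qed.

Let oscillator_energy_ge0 (x y z : R) : 0 <= x ^+ 2 + y ^+ 2 * z ^+ 2.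
Proof. by apply: addr_ge0; [exact: sqr_ge0|apply: mulr_ge0; exact: sqr_ge0]. Qed.

Let energy_ge1 U dU t : 1 <= energy U dU t.
Proof.
by rewrite lerDl sumr_ge0// => k _; exact: oscillator_energy_ge0.
Qed.

Let energy_ge0 U dU t : 0 <= energy U dU t.
Proof. exact: le_trans ler01 (energy_ge1 _ _ _). Qed.

Let energy_ge U dU t k :
  dU k t ^+ 2 + lambda k ^+ 2 * U k t ^+ 2 <= energy U dU t.
Proof.
by rewrite /energy (bigD1 k)//= addrCA lerDl addr_ge0// sumr_ge0// => j _;
  exact: oscillator_energy_ge0.
Qed.

Let normr_le_sqrt (x y : R) : x ^+ 2 <= y -> `|x| <= Num.sqrt y.
Proof. by move=> xy; rewrite -sqrtr_sqr ler_wsqrtr. Qed.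

Let norm_velocity_le U dU t k : `|dU k t| <= Num.sqrt (energy U dU t).
Proof.
apply/normr_le_sqrt/(le_trans _ (energy_ge U dU t k)).
by rewrite lerDl mulr_ge0 ?sqr_ge0.
Qed.

Let norm_position_le U dU t k : `|U k t| <= Num.sqrt (energy U dU t) / lambda k.
Proof.
rewrite ler_pdivlMr// -[X in _ * X](gtr0_norm (lambda_gt0 k)) -normrM.
apply/normr_le_sqrt/(le_trans _ (energy_ge U dU t k)).
by rewrite exprMn mulrC lerDr sqr_ge0.
Qed.

Let unilateral_force_ge0 U k t : 0 <= unilateral_force U k t.
Proof. by rewrite /unilateral_force /pos_part le_max lexx. Qed.

Let unilateral_force_le U dU k t :
  unilateral_force U k t <= gain k * Num.sqrt (energy U dU t).
Proof.
set s := Num.sqrt _; have s1 : 1 <= s by rewrite -sqrtr1 ler_wsqrtr.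
apply: (@le_trans _ _ `|\sum_(j < N) A k j * U j t - b k|).
  by rewrite /unilateral_force /pos_part ge_max normr_ge0 ler_norm.
rewrite (le_trans (ler_normB _ _))// mulrDl lerD//; last by rewrite ler_peMr.
rewrite (le_trans (ler_norm_sum _ _ _))// mulr_suml; apply: ler_sum => j _.
by rewrite normrM -mulrA ler_wpM2l// [_^-1 * _]mulrC norm_position_le.
Qed.

(** The conservative terms cancel in the derivative of the energy, which leaves
- 2 eps * (velocity * force), at most eps times a constant times the energy.
Gronwall's inequality then bounds the energy as long as eps * t stays bounded. *)
Lemma unilateral_force_bounded : exists2 M, 0 <= M &
  forall (eps T : R) U dU, 0 < eps -> eps * T <= 1 -> global_solution eps U dU ->
  forall k (t : R), 0 <= t <= T -> `|unilateral_force U k t| <= M.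
Proof.
pose C := \sum_k gain k.
have C0 : 0 <= C by exact: sumr_ge0.
pose E0 := 1 + \sum_k lambda k ^+ 2 * a k ^+ 2.
exists (C * Num.sqrt (E0 * expR (2 * C))); first by rewrite mulr_ge0.
move=> eps T U dU e0 eT sol k t tT.
rewrite ger0_norm//; apply: le_trans (unilateral_force_le U dU k t) _.
apply: ler_pM => //; first by rewrite /C (bigD1 k)//= lerDl sumr_ge0.
rewrite ler_wsqrtr//.
pose dE s := \sum_k (2 * dU k s * (- eps * unilateral_force U k s - lambda k ^+ 2 * U k s) +
   lambda k ^+ 2 * (2 * U k s * dU k s)).
have hE (s : R) : is_derive s 1 (energy U dU) (dE s).
  apply: is_derive_cstD_pt.
  apply: (@is_derive_sum_pt _ _ (fun k s => dU k s ^+ 2 + lambda k ^+ 2 * U k s ^+ 2)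
    (fun k s => 2 * dU k s * (- eps * unilateral_force U k s - lambda k ^+ 2 * U k s) +
      lambda k ^+ 2 * (2 * U k s * dU k s))) => j.
  have [_ _ hU hdU] := sol j.
  by apply: is_deriveD_pt; [exact: is_derive_sqr_pt|apply/is_deriveZ_pt/is_derive_sqr_pt].
have := @gronwall _ _ _ (2 * C * eps) T hE _ t tT; have -> : energy U dU 0 = E0.
  rewrite /energy; congr (_ + _); apply: eq_bigr => j _.
  by have [-> -> _ _] := sol j; rewrite expr0n add0r.
move=> h; apply: (le_trans (h _)).
  move=> s _; rewrite /dE /C mulr_sumr !mulr_suml; apply: ler_sum => j _.
  have -> : 2 * dU j s * (- eps * unilateral_force U j s - lambda j ^+ 2 * U j s) +
     lambda j ^+ 2 * (2 * U j s * dU j s) =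
     2 * eps * (- (dU j s * unilateral_force U j s)) by ring.
  have -> : 2 * gain j * eps * energy U dU s = 2 * eps *
    (Num.sqrt (energy U dU s) * (gain j * Num.sqrt (energy U dU s))).
    by rewrite -[in LHS](sqr_sqrtr (energy_ge0 U dU s)); ring.
  rewrite ler_wpM2l ?mulr_ge0 ?(ltW e0)//.
  rewrite (le_trans (ler_norm _))// normrN normrM.
  apply: ler_pM => //.
  by rewrite ger0_norm// unilateral_force_le.
have E00 : 0 <= E0.
  by rewrite addr_ge0// sumr_ge0// => j _; rewrite mulr_ge0 ?sqr_ge0.
rewrite ler_wpM2l// ler_expR -mulrA -[leRHS]mulr1 ler_wpM2l ?mulr_ge0//.
apply: le_trans eT; rewrite ler_wpM2l ?(ltW e0)//.
by case/andP: tT.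
Qed.

End PerturbedSystem.

(** * Comparison with the detuned free oscillation *)

Section Comparison.
Context {R : realType}.

Let detuning_phase (lam eps mu T t : R) : 0 < eps -> 0 <= t <= T ->
  `|lam * t - (lam + eps * mu) * t| <= eps * T * `|mu|.
Proof.
move=> e0 /andP[t0 tT].
have -> : lam * t - (lam + eps * mu) * t = - (eps * t * mu) by ring.
rewrite normrN !normrM (gtr0_norm e0) (ger0_norm t0).
by rewrite ler_wpM2r// ler_wpM2l// ltW.
Qed.

Lemma ler_normM (x y c d : R) : `|x| <= c -> `|y| <= d -> `|x * y| <= c * d.
Proof. by move=> xc yd; rewrite normrM ler_pM. Qed.

Lemma ler_normD_le (x y c d : R) : `|x| <= c -> `|y| <= d -> `|x + y| <= c + d.
Proof. by move=> xc yd; rewrite (le_trans (ler_normD _ _))// lerD. Qed.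

(** The three summands bound the difference to a cos ((lam + eps mu) t), its
derivative and its second derivative, where tau = eps * T and d is the square
root of the energy bound of [oscillator_estimate]. *)
Definition closeness_bound (lam a mu M tau : R) : R :=
  let d := Num.sqrt (expR (tau * M) - 1) in
  (d / lam + `|a| * (tau * `|mu|))
  + (d + `|a| * (lam * (tau * `|mu|) + tau * `|mu|))
  + (tau * M + lam * d
     + `|a| * (lam ^+ 2 * (tau * `|mu|) + tau * `|mu| * (2 * lam + tau * `|mu|))).

Lemma closeness_bound_cvg0 lam a mu M (F : set_system R) (tau : R -> R) : Filter F ->
  tau x @[x --> F] --> 0 -> closeness_bound lam a mu M (tau x) @[x --> F] --> 0.
Proof.
move=> FF tau0.
pose d (x : R) := Num.sqrt (expR (x * M) - 1).
have tau_mu (c : R) : tau x * c @[x --> F] --> 0.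
  by rewrite -(mul0r c); apply: cvgM tau0 _; exact: cvg_cst.
have d0 : d (tau x) @[x --> F] --> 0.
  have -> : 0 = Num.sqrt (expR 0 - 1) :> R by rewrite expR0 subrr sqrtr0.
  have e0 := @continuous_cvg _ _ _ F FF _ expR 0 (@continuous_expR R 0) (tau_mu M).
  have e1 : expR (tau x * M) - 1 @[x --> F] --> expR 0 - 1.
    by apply: cvgB; [exact: e0|exact: cvg_cst].
  exact: (@continuous_cvg _ _ _ F FF _ Num.sqrt _ (@sqrt_continuous R _) e1).
have cM (c : R) (f : R -> R) : f x @[x --> F] --> 0 -> c * f x @[x --> F] --> 0.
  by move=> f0; rewrite -(mulr0 c); apply: cvgM f0; exact: cvg_cst.
have cD (f g : R -> R) : f x @[x --> F] --> 0 -> g x @[x --> F] --> 0 ->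
    f x + g x @[x --> F] --> 0.
  by move=> f0 g0; rewrite -(addr0 0); exact: cvgD.
have t0 := tau_mu `|mu|.
rewrite /closeness_bound; apply: (cD); first apply: (cD); apply: (cD).
- by rewrite -(mul0r lam^-1); apply: cvgM d0 _; exact: cvg_cst.
- exact: cM.
- exact: d0.
- by apply: (cM); apply: (cD) => //; exact: cM.
- by apply: (cD); [exact: tau_mu|exact: cM].
- apply: (cM); apply: (cD); first exact: cM.
  by rewrite -(mul0r (2 * lam + 0)); apply: (cvgM t0); apply: (cvgD _ t0); exact: cvg_cst.
Qed.

(** The difference splits as w + a (cos (lam t) - cos (lam' t)).  The first term
is a forced oscillation with zero initial data and force - eps g, the second one
is controlled by the phase shift eps mu t, at most eps T |mu|.  The condition
1 <= T allows eps to be absorbed into eps * T. *)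
Lemma sobolev_detuned_oscillator (lam a mu M eps T : R) (U dU g h : R -> R) :
  0 < lam -> 0 < eps -> 1 <= T -> continuous g ->
  (forall t : R, is_derive t 1 U (dU t)) ->
  (forall t : R, is_derive t 1 dU (- eps * g t - lam ^+ 2 * U t)) ->
  U 0 = a -> dU 0 = 0 ->
  (forall t, 0 <= t <= T -> `|g t| <= M) ->
  (forall t, 0 < t -> h t = U t - a * cos ((lam + eps * mu) * t)) ->
  (sobolev_inf_norm 2 `]0%R, T[ h <= (closeness_bound lam a mu M (eps * T))%:E)%E.
Proof.
move=> lam0 e0 T1 cg dU_ ddU U0 dU0 gM hE.
have T0 : 0 < T by exact: lt_le_trans T1.
set lam' := lam + eps * mu.
have gM' t : 0 <= t <= T -> `|- g t| <= M by move=> tT; rewrite normrN gM.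
have dc (om t : R) : is_derive t 1 (fun s => a * cos (om * s)) (- (a * (om * sin (om * t)))).
  by rewrite -mulrN; apply: is_deriveZ_pt; exact: is_derive_cosM.
have ds (om t : R) : is_derive t 1 (fun s => a * (om * sin (om * s)))
    (a * (om ^+ 2 * cos (om * t))).
  by rewrite expr2 -(mulrA om); do 2 apply: is_deriveZ_pt; exact: is_derive_sinM.
pose w t := U t - a * cos (lam * t).
pose dw t := dU t + a * (lam * sin (lam * t)).
have w_ (t : R) : is_derive t 1 w (dw t).
  by rewrite /dw -[X in _ + X]opprK; exact: (is_deriveB_pt (dU_ t) (dc lam t)).
have dw_ (t : R) : is_derive t 1 dw (eps * (- g t) - lam ^+ 2 * w t).
  have -> : eps * - g t - lam ^+ 2 * w t = (- eps * g t - lam ^+ 2 * U t) +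
     a * (lam ^+ 2 * cos (lam * t)) by rewrite /w; ring.
  exact: (is_deriveD_pt (ddU t) (ds lam t)).
have est := oscillator_estimate (ltW e0) w_ dw_ _ _ gM'.
set tau := eps * T; set d := Num.sqrt (expR (tau * M) - 1).
have e_tau : eps <= tau by rewrite ler_peMr// ltW.
have M0 : 0 <= M by apply: le_trans (gM 0 _) => //; rewrite lexx ltW.
have [dwd wd] : (forall t, 0 <= t <= T -> `|dw t| <= d) /\
    (forall t, 0 <= t <= T -> `|lam * w t| <= d).
  have both t : 0 <= t <= T -> dw t ^+ 2 + (lam * w t) ^+ 2 <= expR (tau * M) - 1.
    move=> tT; rewrite exprMn; apply: le_trans (est _ _ t tT) _.
    - by rewrite /w mulr0 cos0 mulr1 U0 subrr.
    - by rewrite /dw mulr0 sin0 !mulr0 dU0 addr0.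
    - rewrite lerD2r ler_expR /tau mulrAC ler_wpM2r// ler_wpM2l ?(ltW e0)//.
      by case/andP: tT.
  split=> t /both h'; rewrite -sqrtr_sqr ler_wsqrtr//; apply: le_trans h'.
    by rewrite lerDl sqr_ge0.
  by rewrite lerDr sqr_ge0.
pose f t := U t - a * cos (lam' * t).
pose f1 t := dU t + a * (lam' * sin (lam' * t)).
pose f2 t := (- eps * g t - lam ^+ 2 * U t) + a * (lam' ^+ 2 * cos (lam' * t)).
apply: (@sobolev_inf_norm2_le _ _ f f1 f2) => //.
- by move=> t; rewrite /f1 -[X in _ + X]opprK; exact: (is_deriveB_pt (dU_ t) (dc lam' t)).
- have cU := is_derive_continuous dU_.
  have cc : continuous (fun t => cos (lam' * t)) := @continuous_cosM R lam'.
  move=> t; apply: cvgD; last first.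
    by apply: cvgM; [exact: cvg_cst|apply: cvgM; [exact: cvg_cst|exact: cc]].
  by apply: cvgB; apply: cvgM; (exact: cvg_cst || exact: cg || exact: cU).
- by move=> t; rewrite /= in_itv/= => /andP[t0 _]; exact: hE.
move=> t; rewrite /= in_itv/= => /andP[t0 tT].
have tT' : 0 <= t <= T by rewrite !ltW.
have ph := @detuning_phase lam eps mu T t e0 tT'.
have pc : `|cos (lam * t) - cos (lam' * t)| <= tau * `|mu| := le_trans (lipschitz_cos _ _) ph.
have ps : `|sin (lam * t) - sin (lam' * t)| <= tau * `|mu| := le_trans (lipschitz_sin _ _) ph.
have lamn : `|lam| <= lam by rewrite gtr0_norm.
have tm0 : 0 <= tau * `|mu| by rewrite mulr_ge0// /tau mulr_ge0// ltW.
have em : `|eps * mu| <= tau * `|mu| by rewrite normrM (gtr0_norm e0) ler_wpM2r.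
split.
- have -> : f t = w t + a * (cos (lam * t) - cos (lam' * t)) by rewrite /f /w; ring.
  apply: ler_normD_le; last exact: ler_normM.
  by rewrite ler_pdivlMr// mulrC -{1}(gtr0_norm lam0) -normrM wd.
- have -> : f1 t = dw t +
      a * (lam * - (sin (lam * t) - sin (lam' * t)) + eps * mu * sin (lam' * t)).
    by rewrite /f1 /dw /lam'; ring.
  apply: ler_normD_le; first exact: dwd.
  apply: ler_normM => //; apply: ler_normD_le; first by apply: ler_normM; rewrite ?normrN.
  by rewrite -[leRHS]mulr1; apply: ler_normM => //; exact: sin_max.
- have -> : f2 t = (eps * - g t + - (lam * (lam * w t))) +
     a * (lam ^+ 2 * - (cos (lam * t) - cos (lam' * t)) +
       eps * mu * (2 * lam + eps * mu) * cos (lam' * t)).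
    by rewrite /f2 /w /lam'; ring.
  apply: ler_normD_le; first apply: ler_normD_le.
  + by apply: ler_normM; [rewrite gtr0_norm|exact: gM'].
  + by rewrite normrN; apply: ler_normM => //; exact: wd.
  + apply: ler_normM => //; apply: ler_normD_le.
      by apply: ler_normM; rewrite ?normrN// ger0_norm ?sqr_ge0.
    rewrite -[leRHS]mulr1; apply: ler_normM; last exact: cos_max.
    apply: ler_normM => //; apply: ler_normD_le => //.
    by rewrite ger0_norm// mulr_ge0// ltW.
Qed.

End Comparison.

(** * Convergence and frequency shift *)

Theorem theorem2 (R : realType) (N : nat) (lambda : 'I_N -> R) (A : 'M[R]_N)
    (b a : 'I_N -> R) (u : R -> 'I_N -> R -> R)
    (lambda_gt0 : forall k, 0 < lambda k)
    (lambda_indep : lin_indep_int lambda)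
    (a_neq0 : forall k, a k != 0)
    (u_sol : forall eps, 0 < eps -> is_solution lambda A b a eps (u eps)) :
  [/\ forall k : 'I_N, cvg (mean_forcing lambda A b a k T @[T --> +oo]),
      forall Teps : R -> R,
        Teps eps @[eps --> 0^'+] --> +oo ->
        eps * Teps eps @[eps --> 0^'+] --> 0 ->
        forall k : 'I_N,
          sobolev_inf_norm 2 `]0, Teps eps[
            (fun t => u eps k t -
               v0 a k ((lambda k + eps * lambda1 lambda A b a k) * t))
          @[eps --> 0^'+] --> 0%E
    & forall k : 'I_N, b k = 0 ->
        lambda1 lambda A b a k = A k k / (4 * lambda k)].
Proof.
pose om k j := lambda j / lambda k.
pose X k s := \sum_(j < N) A k j * (a j * cos (om k j * s)).
have lam_neq0 k : lambda k != 0 by rewrite gt_eqF.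
have mean_forcingE k : mean_forcing lambda A b a k =
    time_mean (fun s => pos_part (X k s - b k) * cos (om k k * s)).
  apply/funext => T; rewrite /mean_forcing /time_mean; congr (_ * _).
  by apply: eq_Rintegral => s _; rewrite /om divff// mul1r.
split=> [k|Teps Tinfty eT0 k|k bk0].
- have [|l Hl] := @trigsum_pos_part_has_mean R (fun s => X k s - b k) (om k k).
    (* the constant - b k is a multiple of the cosine of frequency 0 *)
    have -> : (fun s => X k s - b k) = (fun s => X k s + (- b k) * cos (0 * s)).
      by apply/funext => s; rewrite mul0r cos0 mulr1.
    apply: trigsumD; last by apply/trigsumZ/trigsum_cos.
    apply: trigsum_sum; first by exists 0.
    by move=> j; do 2 apply: trigsumZ; exact: trigsum_cos.
  by apply/cvg_ex; exists l; rewrite mean_forcingE.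
- set mu := lambda1 lambda A b a k.
  have [M M0 Mbnd] := @unilateral_force_bounded R N lambda A b a lambda_gt0.
  apply: (@squeeze_cvge _ _ _ _ (cst 0%E) _
    (fun eps => (closeness_bound (lambda k) (a k) mu M (eps * Teps eps))%:E)).
  + near=> eps; rewrite sobolev_inf_norm_ge0/=.
    have e0 : 0 < eps by near: eps; exact: nbhs_right_gt.
    have T1 : 1 <= Teps eps by near: eps; move/cvgryPge : Tinfty; apply.
    have eT1 : eps * Teps eps <= 1.
      near: eps; move/cvgrPdist_le : eT0 => /(_ 1 ltr01); apply: filterS => x.
      by rewrite sub0r normrN => /(le_trans (ler_norm _)).
    have [U [dU [sol Uu]]] := is_solution_extend (u_sol _ e0).
    have [Uk0 dUk0 dUk ddUk] := sol k.
    have cU j : continuous (U j) by have [_ _ + _] := sol j => /is_derive_continuous.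
    apply: (sobolev_detuned_oscillator (g := unilateral_force U k) _ e0 T1 _ dUk ddUk) => //.
    * move=> t; apply: continuous_cvg; first exact: continuous_pos_part.
      apply: cvgB; last exact: cvg_cst.
      apply: cvg_big => [|j _]; [exact: add_continuous|]; apply: cvgM; first exact: cvg_cst.
      exact: cU.
    * exact: (Mbnd _ _ _ _ e0 eT1 sol k).
    * by move=> t t0; rewrite Uu// ltW.
  + exact: cvg_cst.
  + by apply/fine_cvgP; split; [near=> eps|exact: closeness_bound_cvg0].
- have li := lin_indep_int_scale (lam_neq0 k) lambda_indep.
  have Hl : has_mean (fun s => pos_part (X k s - b k) * cos (om k k * s)) (A k k * a k / 4).
    have -> : (fun s => pos_part (X k s - b k) * cos (om k k * s)) =
      (fun s => pos_part (\sum_j (A k j * a j) * cos (om k j * s)) * cos (om k k * s)).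
      apply/funext => s; rewrite bk0 subr0; congr (pos_part _ * _).
      by apply: eq_bigr => j _; rewrite mulrA.
    exact: (@has_mean_pos_part_indep R N (om k) (fun j => A k j * a j) k li).
  rewrite /lambda1 mean_forcingE (cvg_lim _ Hl)//.
  by field; rewrite lam_neq0 a_neq0.
Unshelve. all: by end_near. Qed.
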